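(* Let $a, b > 0$ be real numbers, let $w_n = an+b$ for $n \ge 0$, and let $M$ be the weighted mean matrix associated with the weight sequence $\{w_n\}_{n\ge 0}$, i.e. the lower triangular infinite matrix $M = [m_{ij}]_{i,j \ge 0}$ with $m_{ij} = w_j / W_i$ for $j \le i$ and $m_{ij} = 0$ for $j > i$, where $W_i = \sum_{j=0}^{i} w_j$. Then $M$ is a posinormal operator on $\ell^2$.
   Context: Here $\ell^2$ is the Hilbert space of square-summable sequences indexed by $n = 0, 1, 2, \dots$, and an infinite matrix acts on $\ell^2$ with respect to the standard orthonormal basis by $(Mf)_i = \sum_j m_{ij} f_j$. For a Hilbert space $H$, $\mathcal{B}(H)$ denotes the set of all bounded linear operators on $H$. An operator $A \in \mathcal{B}(H)$ is posinormal if $AA^* = A^*PA$ for some positive operator $P \in \mathcal{B}(H)$, where positive means $\langle Pf, f\rangle \ge 0$ for all $f \in H$. Thus calling $M$ a posinormal operator on $\ell^2$ includes that $M$ defines a bounded operator on $\ell^2$. *)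

(* Defs.v *)
From HB Require Import structures.
From mathcomp Require Import all_boot all_order all_algebra.
From mathcomp Require Import sesquilinear complex lra.
From mathcomp Require Import all_classical all_reals all_analysis.

Set Implicit Arguments.
Unset Strict Implicit.
Unset Printing Implicit Defensive.

Import Order.TTheory GRing.Theory Num.Theory Num.Def.
Import numFieldNormedType.Exports.

Local Open Scope classical_set_scope.
Local Open Scope ring_scope.
Local Open Scope complex_scope.

(* R[i] itself carries no topology; packed as a numClosedFieldType it gets the
   one induced by its norm. *)
Definition Cplx (R : realType) : numClosedFieldType := R[i].

Section complex_sequences.
Variable R : realType.
Implicit Types (u : nat -> Cplx R) (v : nat -> R) (z : Cplx R).

Local Notation normc := (@ComplexField.Normc.normc R).

Lemma norm_Cplx z : `|z| = (normc z)%:C.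
Proof. by case: z. Qed.

Lemma sqr_norm_Cplx z : `|z| ^+ 2 = (normc z ^+ 2)%:C.
Proof. by rewrite norm_Cplx [RHS]rmorphXn. Qed.

Lemma normc_ge0 z : 0 <= normc z.
Proof. by case: z => x y; exact: sqrtr_ge0. Qed.

Lemma normc_sqr_norm z : normc (`|z| ^+ 2) = normc z ^+ 2.
Proof.
by rewrite sqr_norm_Cplx /= expr0n addr0 sqrtr_sqr ger0_norm ?sqr_ge0.
Qed.

Lemma ler_normc_Re z : `|complex.Re z| <= normc z.
Proof.
by case: z => x y /=; rewrite -sqrtr_sqr ler_wsqrtr// lerDl sqr_ge0.
Qed.

Lemma ler_normc_Im z : `|complex.Im z| <= normc z.
Proof.
by case: z => x y /=; rewrite -sqrtr_sqr ler_wsqrtr// lerDr sqr_ge0.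
Qed.

Lemma cvg_real_complex v (l : R) :
  v @ \oo --> l -> (fun n => (v n)%:C : Cplx R) @ \oo --> (l%:C : Cplx R).
Proof.
move=> /cvgrPdist_lt vl; apply/cvgrPdist_lt => e e0.
have [r r0 er] : exists2 r : R, 0 < r & e = r%:C.
  move: e0; case: e => x y; rewrite ltcE /= => /andP[/eqP -> x0].
  by exists x.
near=> n; rewrite er norm_Cplx ltcR -rmorphB /= expr0n addr0 sqrtr_sqr.
by near: n; exact: vl.
Unshelve. all: by end_near. Qed.

Lemma cvgDM (K : numFieldType) (f g : nat -> K) (c a b : K) :
  f @ \oo --> a -> g @ \oo --> b ->
  (fun n => f n + c * g n) @ \oo --> a + c * b.
Proof. by move=> fa gb; apply: cvgD => //; apply: cvgM => //; exact: cvg_cst. Qed.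

Lemma cvg_Cplx u (l : Cplx R) :
  (fun n => complex.Re (u n)) @ \oo --> complex.Re l ->
  (fun n => complex.Im (u n)) @ \oo --> complex.Im l -> u @ \oo --> l.
Proof.
move=> /cvg_real_complex ul /cvg_real_complex ul'.
rewrite [l]complexE.
rewrite (_ : u = fun n =>
  (complex.Re (u n))%:C + 'i%C * (complex.Im (u n))%:C); last first.
  by apply/funext => n; rewrite [LHS]complexE.
exact (@cvgDM (Cplx R) (fun n => (complex.Re (u n))%:C)
  (fun n => (complex.Im (u n))%:C) 'i%C _ _ ul ul').
Qed.

Lemma cvg_Re u (l : Cplx R) :
  u @ \oo --> l -> (fun n => complex.Re (u n)) @ \oo --> complex.Re l.
Proof.
move=> /cvgrPdist_lt ul; apply/cvgrPdist_lt => e e0.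
near=> n; have : `|l - u n| < e%:C.
  by near: n; apply: ul; rewrite ltcR.
rewrite norm_Cplx ltcR; apply: le_lt_trans.
by apply: le_trans (ler_normc_Re _); case: (l) => ? ?; case: (u n).
Unshelve. all: by end_near. Qed.

Lemma Re_series u n :
  complex.Re (series u n) = series (fun k => complex.Re (u k)) n.
Proof.
rewrite /series /=.
by apply: (big_morph (@complex.Re R)) => // -[? ?] [? ?].
Qed.

Lemma Im_series u n :
  complex.Im (series u n) = series (fun k => complex.Im (u k)) n.
Proof.
rewrite /series /=.
by apply: (big_morph (@complex.Im R)) => // -[? ?] [? ?].
Qed.

Lemma is_cvg_series_dominated u v :
  (forall n, normc (u n) <= v n) -> cvgn (series v) -> cvgn (series u).
Proof.
move=> uv cv.
have cRe : cvgn (series (fun k => complex.Re (u k))).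
  apply: normed_cvg; apply: (series_le_cvg _ _ _ cv) => n //=.
  - exact: le_trans (normr_ge0 _) (le_trans (ler_normc_Re _) (uv n)).
  - exact: le_trans (ler_normc_Re _) (uv n).
have cIm : cvgn (series (fun k => complex.Im (u k))).
  apply: normed_cvg; apply: (series_le_cvg _ _ _ cv) => n //=.
  - exact: le_trans (normr_ge0 _) (le_trans (ler_normc_Re _) (uv n)).
  - exact: le_trans (ler_normc_Im _) (uv n).
apply/cvg_ex; exists (limn (series (fun k => complex.Re (u k)))
  +i* limn (series (fun k => complex.Im (u k)))).
apply: cvg_Cplx => /=.
  by under eq_fun do rewrite Re_series.
by under eq_fun do rewrite Im_series.
Qed.

Definition square_summable u : Prop := cvgn (series (fun n => `|u n| ^+ 2)).

Lemma square_summableP u :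
  square_summable u <-> cvgn (series (fun n => normc (u n) ^+ 2)).
Proof.
split=> [/cvg_ex[l ul]|cu].
  apply/cvg_ex; exists (complex.Re l); move/cvg_Re: ul.
  rewrite (_ : (fun n => _) = series (fun n => normc (u n) ^+ 2))//.
  apply/funext => n; rewrite Re_series /series /=; apply: eq_bigr => k _.
  exact: (congr1 (@complex.Re R) (sqr_norm_Cplx (u k))).
by apply: is_cvg_series_dominated cu => n; rewrite normc_sqr_norm.
Qed.

Definition l2_pred : {pred nat -> Cplx R} := fun u => `[< square_summable u >].

Lemma l2_submod_closed : submod_closed l2_pred.
Proof.
split.
  apply/asboolP/square_summableP.
  rewrite (_ : series _ = cst 0); first exact: is_cvg_cst.
  apply/funext => n; rewrite /series /= big1// => i _.
  by rewrite /= expr0n addr0 sqrtr0 expr0n.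
move=> a f g /asboolP/square_summableP cf /asboolP/square_summableP cg.
apply/asboolP/square_summableP.
have ch : cvgn (series ((2 * normc a ^+ 2) *: (fun n => normc (f n) ^+ 2)
                        + 2 *: (fun n => normc (g n) ^+ 2))).
  by apply: is_cvg_seriesD; exact: is_cvg_seriesZ.
apply: (series_le_cvg _ _ _ ch) => n; first exact: sqr_ge0.
  by apply: addr_ge0; apply: mulr_ge0; rewrite ?mulr_ge0 ?exprn_ge0 ?normc_ge0.
rewrite -[leRHS]/(2 * normc a ^+ 2 * normc (f n) ^+ 2 + 2 * normc (g n) ^+ 2).
rewrite -[leLHS]/(normc (a * f n + g n) ^+ 2).
have : normc (a * f n + g n) <= normc a * normc (f n) + normc (g n).
  by rewrite -ComplexField.Normc.normcM; exact: le_normcD.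
move: (normc_ge0 (a * f n + g n)).
move: (normc a) (normc (f n)) (normc (g n)) (normc (_ + _)) => x y z w w0 wxyz.
apply: (@le_trans _ _ ((x * y + z) ^+ 2)).
  by rewrite ler_pXn2r ?nnegrE// (le_trans w0).
have := sqr_ge0 (x * y - z); rewrite -subr_ge0 => /le_trans; apply.
by rewrite -subr_ge0; lra.
Qed.

HB.instance Definition _ :=
  GRing.isSubmodClosed.Build (Cplx R) (nat -> Cplx R) l2_pred l2_submod_closed.

End complex_sequences.

Record l2 (R : realType) := L2 {
  l2_val :> nat -> Cplx R ;
  l2_valP : l2_val \in @l2_pred R
}.

Section l2_space.
Variable R : realType.

HB.instance Definition _ := [isSub of l2 R for @l2_val R].
HB.instance Definition _ := [Choice of l2 R by <:].
HB.instance Definition _ := [SubChoice_isSubLmodule of l2 R by <:].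

Implicit Types f g h : l2 R.

Definition l2_dot f g : Cplx R := limn (series (fun n => f n * conjC (g n))).

Local Notation normc := (@ComplexField.Normc.normc R).

Lemma cvg_l2_dot f g :
  series (fun n => f n * conjC (g n)) @ \oo --> l2_dot f g.
Proof.
apply: (@is_cvg_series_dominated _ _
  ((fun n => normc (f n) ^+ 2) + (fun n => normc (g n) ^+ 2))) => [n|].
  rewrite ComplexField.Normc.normcM.
  have -> : normc (conjC (g n)) = normc (g n).
    by case: (g n) => x y /=; rewrite sqrrN.
  rewrite -[leRHS]/(normc (f n) ^+ 2 + normc (g n) ^+ 2).
  move: (normc_ge0 (f n)) (normc_ge0 (g n)).
  move: (normc _) (normc _) => x y x0 y0.
  rewrite -subr_ge0; have := sqr_ge0 (x - y).
  have := mulr_ge0 x0 y0; lra.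
have /asboolP/square_summableP cf := l2_valP f.
have /asboolP/square_summableP cg := l2_valP g.
exact: is_cvg_seriesD.
Qed.

Lemma l2_dot_linearl h : scalar (l2_dot^~ h).
Proof.
move=> a f g; apply: cvg_lim => //.
rewrite (_ : series _ = fun n => series (fun k => g k * conjC (h k)) n
  + a * series (fun k => f k * conjC (h k)) n); last first.
  apply/funext => n; rewrite /series /= mulr_sumr -big_split.
  by apply: eq_bigr => k _ /=; rewrite mulrDl addrC mulrA.
rewrite addrC; apply: cvgDM; exact: cvg_l2_dot.
Qed.

Lemma cvg_conjC (K : numClosedFieldType) (u : nat -> K) (l : K) :
  u @ \oo --> l -> (fun n => conjC (u n)) @ \oo --> conjC l.
Proof.
move=> /cvgrPdist_lt ul; apply/cvgrPdist_lt => e e0.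
by near=> n; rewrite -rmorphB norm_conjC; near: n; exact: ul.
Unshelve. all: by end_near. Qed.

Lemma l2_dotC f g : l2_dot f g = conjC (l2_dot g f).
Proof.
apply: cvg_lim => //; have := cvg_conjC (@cvg_l2_dot g f).
rewrite (_ : (fun n => conjC _) = series (fun n => f n * conjC (g n)))//.
apply/funext => n; rewrite /series /= rmorph_sum.
by apply: eq_bigr => k _; rewrite rmorphM /= conjCK mulrC.
Qed.

Lemma l2_dot_linearr f : linear_for (conjC \; *%R) (l2_dot f).
Proof.
move=> a g h /=.
by rewrite l2_dotC l2_dot_linearl rmorphD rmorphM /= -!l2_dotC.
Qed.

HB.instance Definition _ := bilinear_isBilinear.Build (Cplx R) (l2 R) (l2 R)
  (Cplx R) _ _ l2_dot (l2_dot_linearl, l2_dot_linearr).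

Lemma l2_dot_hermitian f g : l2_dot f g = (-1) ^+ false * conjC (l2_dot g f).
Proof. by rewrite mul1r l2_dotC. Qed.

HB.instance Definition _ := isHermitianSesquilinear.Build (Cplx R) (l2 R)
  false conjC l2_dot l2_dot_hermitian.

Lemma l2_dot_gt0 f : f != 0 -> 0 < l2_dot f f.
Proof.
move=> f0.
have [m fm] : exists m, f m != 0.
  apply: contrapT => /forallNP f0'; move/eqP: f0; apply; apply/val_inj/funext.
  by move=> n; have /negP := f0' n; rewrite negbK => /eqP.
have fE n : series (fun k => f k * conjC (f k)) n
            = (series (fun k => normc (f k) ^+ 2) n)%:C.
  rewrite /series /= rmorph_sum; apply: eq_bigr => k _.
  by rewrite -normCK sqr_norm_Cplx.
have := @cvg_l2_dot f f; rewrite (funext fE) => cf.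
have /asboolP/square_summableP cf' := l2_valP f.
have := cvg_real_complex cf'.
move=> /(cvg_unique _ cf) -> //.
rewrite ltcR; apply: (@lt_le_trans _ _ (series (fun k => normc (f k) ^+ 2) m.+1)).
  rewrite /series /= big_nat_recr//= ltr_wpDl//.
    by apply: sumr_ge0 => k _; exact: sqr_ge0.
  rewrite exprn_gt0// lt_neqAle normc_ge0 andbT eq_sym.
  by apply: contra fm => /eqP/ComplexField.Normc.eq0_normc ->.
apply: nondecreasing_cvgn_le => //.
by apply/nondecreasing_seqP => n; rewrite /series /= big_nat_recr//= lerDl sqr_ge0.
Qed.

HB.instance Definition _ := isDotProduct.Build (Cplx R) (l2 R) l2_dot l2_dot_gt0.

End l2_space.

Section operators.
Variables (C : numClosedFieldType) (H : lmodType C) (dot : {dot H for conjC}).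

Definition dot_norm (f : H) : C := sqrtC (dot f f).

Definition bounded_operator (A : H -> H) : Prop :=
  exists c : C, forall f, dot_norm (A f) <= c * dot_norm f.

Definition adjoint_operator (A B : H -> H) : Prop :=
  forall f g, dot (A f) g = dot f (B g).

Definition positive_operator (A : H -> H) : Prop :=
  forall f, 0 <= dot (A f) f.

(* An adjoint is unique because dot is definite, and the adjoint of a bounded
   operator is bounded; As is thus the operator written A^* in A A^* = A^* P A. *)
Definition posinormal (A : {linear H -> H}) : Prop :=
  bounded_operator A /\
  exists As P : {linear H -> H},
    [/\ adjoint_operator A As, bounded_operator P, positive_operator P &
        A \o As =1 As \o P \o A].

End operators.

Definition acts_as_matrix (R : realType) (m : nat -> nat -> Cplx R)
    (A : l2 R -> l2 R) : Prop :=
  forall (f : l2 R) (i : nat), series (fun j => m i j * f j) @ \oo --> A f i.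

Definition weighted_mean (R : realType) (w : nat -> R) (i j : nat) : R :=
  if (j <= i)%N then w j / \sum_(0 <= k < i.+1) w k else 0.

(* Main.v *)
(* Let W_i be the partial sums of the weights.  The matrix M^* has the formal
   inverse g |-> (W_i (g_i / w_i - g_{i+1} / w_{i+1}))_i; composed with M it gives
   an operator B with M = M^* B, because the sum defining (M^* B f)_i telescopes.
   Explicitly (B f)_i = c_i (M f)_i - (W_i / W_{i+1}) f_{i+1} with
   c_i = W_i (1 / w_i - W_i / (w_{i+1} W_{i+1})), so B is bounded as soon as M is
   bounded and c is; M is bounded by Hardy's inequality, valid for nondecreasing
   weights, and for w_n = a n + b one has c_i <= 2 + a / b.  Taking adjoints,
   M^* = B^* M, whence M M^* = M^* B B^* M and P = B B^* is positive. *)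

From HB Require Import structures.
Require Import Defs.
From mathcomp Require Import all_boot all_order all_algebra.
From mathcomp Require Import sesquilinear complex.
From mathcomp Require Import all_classical all_reals all_analysis.
From mathcomp Require Import ring lra.

Import Order.TTheory GRing.Theory Num.Theory Num.Def.
Import numFieldNormedType.Exports.

Local Open Scope ring_scope.
Local Open Scope classical_set_scope.

Set Implicit Arguments.
Unset Strict Implicit.
Unset Printing Implicit Defensive.

(** * Orthogonal projection and the Cauchy-Schwarz inequality *)

Section dot_product.
Context {C : numClosedFieldType} {H : lmodType C} (dot : {dot H for conjC}).

Local Notation "''[' u , v ]" := (dot u%R v%R) : ring_scope.
Local Notation "''[' u ]" := '[u, u]%R : ring_scope.

(* The library's CauchySchwarz needs a finite-dimensional space (vectType). *)
Lemma dot_CauchySchwarz (u v : H) : `|'[u, v]| ^+ 2 <= '[u] * '[v].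
Proof.
have [->|v0] := eqVneq v 0.
  by rewrite (linear0r dot u) (linear0r dot 0) mulr0 normr0 expr0n.
have dv : 0 < '[v] by rewrite dnorm_gt0.
(* [a *: v] is the orthogonal projection of [u] on the line of [v]; the remainder has nonnegative
   square norm. *)
pose a := '[u, v] / '[v].
have ou : '[u - a *: v, v] = 0.
  by rewrite linearBl/= linearZl_LR /= divfK ?subrr// gt_eqF.
have : 0 <= '[u - a *: v, u - a *: v] by exact: dnorm_ge0.
rewrite [X in 0 <= X](_ : _ =
  '[u - a *: v, u] - conjC a * '[u - a *: v, v]); last first.
  by rewrite [LHS]linearBr /= [X in _ - X = _]linearZr_LR.
rewrite ou mulr0 subr0 linearBl/= linearZl_LR /=.
rewrite [dot v u]hermC expr0 mul1r subr_ge0 mulrAC ler_pdivrMr//.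
by rewrite normCK.
Qed.

End dot_product.

(** * Bounded operators on l2, their adjoints, and a factorization criterion *)

Section l2_operators.
Context {R : realType}.
Implicit Types (f g : l2 R) (u : nat -> Cplx R).

Local Notation normc := (@ComplexField.Normc.normc R).
Local Notation psum u n := (\sum_(0 <= k < n) normc (u k) ^+ 2).
Local Notation "''[' f , g ]" := (@l2_dot R f g).
Local Notation "''[' f ]" := '[f, f].

Lemma psum_homo u : {homo (fun n => psum u n) : m n / (m <= n)%N >-> m <= n}.
Proof.
by apply/nondecreasing_seqP => n; rewrite big_nat_recr//= lerDl sqr_ge0.
Qed.

(** Taken in [R] rather than [Cplx R], so that estimates can use the total order of the reals. *)
Definition l2_sqnorm f : R := limn (series (fun k => normc (f k) ^+ 2)).

Lemma l2_dotE f : '[f] = (l2_sqnorm f)%:C%C.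
Proof.
have /asboolP/square_summableP/cvg_real_complex cf := l2_valP f.
apply: cvg_lim => //; apply: cvg_trans cf.
rewrite [X in X @ _](_ : _ =
  (fun n => (series (fun k => normc (f k) ^+ 2) n)%:C%C : Cplx R)) //.
apply/funext => n; rewrite /series /= rmorph_sum.
by apply: eq_bigr => k _; rewrite -normCK sqr_norm_Cplx.
Qed.

Lemma psum_le_sqnorm f n : psum f n <= l2_sqnorm f.
Proof.
have /asboolP/square_summableP cf := l2_valP f.
exact: (nondecreasing_cvgn_le (psum_homo f) cf).
Qed.

Lemma l2_sqnorm_le f (c : R) : (forall n, psum f n <= c) -> l2_sqnorm f <= c.
Proof.
have /asboolP/square_summableP cf := l2_valP f.
by move=> fc; apply: limr_le => //; near=> n; exact: fc.
Unshelve. all: by end_near. Qed.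

Lemma l2_pred_psum u (c : R) : (forall n, psum u n <= c) -> u \in @l2_pred R.
Proof.
move=> uc; apply/asboolP/square_summableP.
apply: nondecreasing_is_cvgn; first exact: psum_homo.
by exists c => _ [n _ <-]; exact: uc.
Qed.

Lemma l2_sqnorm_ge0 f : 0 <= l2_sqnorm f.
Proof. by apply: le_trans (psum_le_sqnorm f 0); rewrite big_geq. Qed.

(** Bounds on finite sums give both square-summability of [T f] and the operator bound. The right
    side has [n.+1] terms because the factor B reads one entry ahead. *)
Lemma l2_operator_of_psum (T : (nat -> Cplx R) -> nat -> Cplx R) (c : R) :
    linear T -> 0 <= c ->
    (forall u n, psum (T u) n <= c * psum u n.+1) ->
  exists2 A : {linear l2 R -> l2 R}, forall f, A f = T f :> (nat -> Cplx R) &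
    forall f, '[A f] <= c%:C%C * '[f].
Proof.
move=> linT c0 Tc.
have Tc' f n : psum (T f) n <= c * l2_sqnorm f.
  by apply: le_trans (Tc f n) _; rewrite ler_wpM2l// psum_le_sqnorm.
pose A0 f := L2 (l2_pred_psum (Tc' f)).
have linA0 : linear A0.
  by move=> a f g; apply/val_inj; exact: linT.
pose A : {linear l2 R -> l2 R} :=
  HB.pack A0 (GRing.isLinear.Build _ _ _ _ A0 linA0).
exists A => // f; rewrite !l2_dotE -rmorphM lecR.
by apply: l2_sqnorm_le => n; exact: Tc'.
Qed.

Lemma l2_delta_subproof i : (fun k => (k == i)%:R) \in @l2_pred R.
Proof.
apply: (@l2_pred_psum _ 1) => n.
apply: (le_trans (psum_homo _ (leq_maxl n i.+1))).
rewrite (bigD1_seq i) ?iota_uniq ?mem_index_iota ?leq_maxr//=.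
rewrite eqxx ComplexField.Normc.normc1 expr1n big1 ?addr0// => k /negPf ->.
by rewrite ComplexField.Normc.normc0 expr0n.
Qed.

Definition l2_delta i : l2 R := L2 (l2_delta_subproof i).

Lemma l2_dot_delta f i : '[f, l2_delta i] = f i.
Proof.
apply: cvg_lim => //; apply: cvg_near_cst; near=> n.
rewrite /series /= (bigD1_seq i) ?iota_uniq ?mem_index_iota//=; last first.
  by near: n; exists i.+1.
rewrite eqxx rmorph1 mulr1 big1 ?addr0// => k /negPf ->.
by rewrite rmorph0 mulr0.
Unshelve. all: by end_near. Qed.

(** A combination of basis vectors rather than a cut-off sequence, so that linear maps pass through
    the sum. *)
Definition l2_trunc u n : l2 R := \sum_(0 <= i < n) u i *: l2_delta i.

Lemma l2_dot_truncl u n g :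
  '[l2_trunc u n, g] = \sum_(0 <= i < n) u i * conjC (g i).
Proof.
rewrite /l2_trunc -[LHS]applyrE linear_sum; apply: eq_bigr => i _ /=.
by rewrite linearZl_LR /= l2_dotC l2_dot_delta.
Qed.

Lemma l2_truncE u n k : (k < n)%N -> l2_trunc u n k = u k.
Proof.
move=> kn; rewrite -l2_dot_delta l2_dot_truncl.
rewrite (bigD1_seq k) ?iota_uniq ?mem_index_iota//=.
rewrite eqxx rmorph1 mulr1 big1 ?addr0// => i /negPf ->.
by rewrite rmorph0 mulr0.
Qed.

Lemma l2_dot_trunc u n : '[l2_trunc u n] = (psum u n)%:C%C.
Proof.
rewrite l2_dot_truncl rmorph_sum; apply: eq_big_nat => i /andP[_ ni].
by rewrite l2_truncE// -normCK sqr_norm_Cplx.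
Qed.

(** Pythagoras: truncation is an orthogonal projection, so both cross terms equal the square norm of
    the truncation. *)
Lemma l2_dotB_trunc f n : '[f - l2_trunc f n] = (l2_sqnorm f - psum f n)%:C%C.
Proof.
have e : '[l2_trunc f n, f] = (psum f n)%:C%C.
  rewrite l2_dot_truncl rmorph_sum; apply: eq_big_nat => i /andP[_ ni].
  by rewrite -normCK sqr_norm_Cplx.
have e' : '[f, l2_trunc f n] = (psum f n)%:C%C.
  by rewrite l2_dotC e; apply/eqP; rewrite eq_complex /= oppr0 !eqxx.
rewrite linearBl /= [X in X - _]linearBr [X in _ - X]linearBr /=.
by rewrite e e' l2_dotE l2_dot_trunc subrr subr0 rmorphB.
Qed.

(* The i-th coordinate of the adjoint at g is <g, A e_i>; testing A against the
   truncations of this sequence gives its square-summability. *)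
Lemma l2_adjoint (A : {linear l2 R -> l2 R}) (c : R) :
    0 <= c -> (forall f, '[A f] <= c%:C%C * '[f]) ->
  exists2 As : {linear l2 R -> l2 R}, adjoint_operator (@l2_dot R) A As &
    forall f, '[As f] <= c%:C%C * '[f].
Proof.
move=> c0 Ac.
pose as0 g i := '[g, A (l2_delta i)].
have Atr u n g : '[A (l2_trunc u n), g] =
    \sum_(0 <= i < n) u i * conjC (as0 g i).
  rewrite /l2_trunc linear_sum -[LHS]applyrE linear_sum.
  apply: eq_bigr => i _ /=.
  by rewrite linearZ /= linearZl_LR /= l2_dotC.
have asc g n : psum (as0 g) n <= c * l2_sqnorm g.
  have := dot_CauchySchwarz (@l2_dot R) (A (l2_trunc (as0 g) n)) g.
  rewrite /= [X in `|X|]Atr.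
  rewrite (_ : \sum_(0 <= i < n) _ = (psum (as0 g) n)%:C%C); last first.
    by rewrite rmorph_sum; apply: eq_bigr => i _; rewrite -normCK sqr_norm_Cplx.
  set s := psum _ _; have s0 : 0 <= s by apply: sumr_ge0 => i _; exact: sqr_ge0.
  have := Ac (l2_trunc (as0 g) n); rewrite l2_dot_trunc -/s !l2_dotE.
  rewrite ger0_norm ?lecR// -rmorphXn -!rmorphM !lecR.
  move: (l2_sqnorm _) (l2_sqnorm g) (l2_sqnorm_ge0 g) => x y y0 xs ss.
  (* Since [s ^+ 2 <= x * y] and [x <= c * s], cancelling one factor [s > 0] gives [s <= c * y]. *)
  have [s1|s1] := ltP 0 s; last by apply: le_trans s1 _; exact: mulr_ge0.
  rewrite -(ler_pM2r s1) -expr2 (le_trans ss)// mulrAC.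
  exact: ler_wpM2r.
pose As0 g := L2 (l2_pred_psum (asc g)).
have linAs : linear As0.
  by move=> a f g; apply/val_inj/funext => i; exact: l2_dot_linearl.
pose As : {linear l2 R -> l2 R} :=
  HB.pack As0 (GRing.isLinear.Build _ _ _ _ As0 linAs).
exists As; last first.
  move=> g; rewrite !l2_dotE -rmorphM lecR.
  by apply: l2_sqnorm_le => n; exact: asc.
move=> f g.
(* The partial sums of the dot product of [f] with [As g] are those of [A] at truncations of [f]
   against [g]; they converge by Cauchy-Schwarz and the bound on [A]. *)
apply/esym; apply: cvg_lim => //.
rewrite (_ : series _ = fun n => '[A (l2_trunc f n), g]); last first.
  by apply/funext => n; rewrite Atr.
have cf : series (fun k => normc (f k) ^+ 2) @ \oo --> l2_sqnorm f.
  by have /asboolP/square_summableP := l2_valP f.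
(* The added 1 keeps the divisor positive when [c] or [g] vanishes. *)
have cg : 0 < c * l2_sqnorm g + 1.
  by rewrite ltr_wpDl// mulr_ge0// l2_sqnorm_ge0.
apply/cvgrPdist_lt => e e0.
have [r r0 er] : exists2 r : R, 0 < r & e = r%:C%C.
  move: e0; case: e => x y; rewrite ltcE /= => /andP[/eqP -> x0].
  by exists x.
near=> n.
have : `|'[A f, g] - '[A (l2_trunc f n), g]| ^+ 2 < e ^+ 2.
  rewrite -[X in `|X|](linearBl (@l2_dot R)) -linearB /=.
  apply: le_lt_trans (dot_CauchySchwarz (@l2_dot R) _ _) _ => /=.
  have := Ac (f - l2_trunc f n).
  rewrite l2_dotB_trunc !l2_dotE er -!rmorphM -rmorphXn lecR ltcR => Ah.
  apply: (@le_lt_trans _ _ ((l2_sqnorm f - psum f n) * (c * l2_sqnorm g + 1))).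
    apply: (le_trans (ler_wpM2r (l2_sqnorm_ge0 g) Ah)).
    rewrite mulrAC mulrC ler_wpM2l ?subr_ge0 ?psum_le_sqnorm//.
    by rewrite lerDl.
  rewrite -ltr_pdivlMr//.
  apply: le_lt_trans (ler_norm _) _; near: n.
  move/cvgrPdist_lt: cf; apply.
  by rewrite divr_gt0// exprn_gt0.
by rewrite ltr_pXn2r// nnegrE ltW.
Unshelve. all: by end_near. Qed.

(** The last hypothesis is A = A^* B read coordinatewise, in a form that does not mention the
    adjoint. *)
Lemma posinormal_of_factor (A B : {linear l2 R -> l2 R}) (c d : R) :
    0 <= c -> (forall f, '[A f] <= c%:C%C * '[f]) ->
    0 <= d -> (forall f, '[B f] <= d%:C%C * '[f]) ->
    (forall f i, A f i = '[B f, A (l2_delta i)]) ->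
  posinormal (@l2_dot R) A.
Proof.
move=> c0 Ac d0 Bd AB.
have bop (T : l2 R -> l2 R) (k : R) : 0 <= k ->
    (forall f, '[T f] <= k%:C%C * '[f]) -> bounded_operator (@l2_dot R) T.
  move=> k0 Tk; have k0' : 0 <= k%:C%C :> Cplx R by rewrite lecR.
  exists (sqrtC k%:C%C) => f.
  have dn h : 0 <= '[h] := dnorm_ge0 (@l2_dot R) h.
  rewrite -sqrtCM ?nnegrE; [|exact: k0'|exact: dn].
  rewrite ler_sqrtC ?nnegrE; [exact: Tk|exact: dn|].
  exact: mulr_ge0 k0' (dn f).
split; first exact: bop c0 Ac.
have [As AsE Asc] := l2_adjoint c0 Ac.
have [Bs BsE Bsd] := l2_adjoint d0 Bd.
have adjC (T Ts : {linear l2 R -> l2 R}) : adjoint_operator (@l2_dot R) T Ts ->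
    forall f g, '[Ts f, g] = '[f, T g].
  by move=> TTs f g; rewrite l2_dotC -TTs -l2_dotC.
have ABs f : As (B f) = A f.
  by apply/val_inj/funext => i /=; rewrite AB -l2_dot_delta (adjC A).
have BsA f : Bs (A f) = As f.
  apply/val_inj/funext => i /=.
  by rewrite -!l2_dot_delta (adjC B)// [RHS](adjC A)// AsE ABs.
exists As, (B \o Bs); split => //.
- apply: (bop _ (d * d)); first exact: mulr_ge0.
  move=> f; apply: le_trans (Bd _) _; rewrite rmorphM -mulrA.
  by apply: ler_wpM2l => //; rewrite lecR.
- by move=> f; rewrite /= BsE; exact: (dnorm_ge0 (@l2_dot R)).
- by move=> f /=; rewrite BsA ABs.
Qed.

End l2_operators.

(** * Weighted mean matrices with positive nondecreasing weights *)

Section weighted_means.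
Context {R : realType}.
Variable w : nat -> R.
Hypothesis w_gt0 : forall n, 0 < w n.
Hypothesis w_ndecr : forall n, w n <= w n.+1.

Local Notation normc := (@ComplexField.Normc.normc R).
Local Notation W n := (\sum_(0 <= k < n.+1) w k).

Let W_gt0 n : 0 < W n.
Proof.
by rewrite big_nat_recr//= ltr_wpDl// sumr_ge0// => k _; exact: ltW.
Qed.

Let WS n : W n.+1 = W n + w n.+1.
Proof. by rewrite big_nat_recr. Qed.

Let weighted_meanE n j : (j <= n)%N -> weighted_mean w n j = w j / W n.
Proof. by rewrite /weighted_mean => ->. Qed.

Lemma weighted_mean_sumS (F : nat -> R) n :
  W n.+1 * (\sum_(0 <= k < n.+2) weighted_mean w n.+1 k * F k) =
  W n * (\sum_(0 <= k < n.+1) weighted_mean w n k * F k) + w n.+1 * F n.+1.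
Proof.
have key m : W m * (\sum_(0 <= k < m.+1) weighted_mean w m k * F k) =
    \sum_(0 <= k < m.+1) w k * F k.
  rewrite mulr_sumr; apply: eq_big_nat => k /andP[_ km].
  by rewrite weighted_meanE// mulrA mulrCA mulfV ?gt_eqF// mulr1.
by rewrite !key big_nat_recr.
Qed.

Lemma weighted_mean_Hardy (x : nat -> R) n :
  \sum_(0 <= i < n) (\sum_(0 <= k < i.+1) weighted_mean w i k * x k) ^+ 2
    <= 4 * \sum_(0 <= i < n) x i ^+ 2.
Proof.
pose y i := \sum_(0 <= k < i.+1) weighted_mean w i k * x k.
rewrite -/(y _); case: n => [|n]; first by rewrite !big_geq// mulr0.
(* The boundary term makes the induction work: with t = W_n / w_{n+1}, the step is
   4 x^2 - (2 t + 3) y'^2 + 2 t y^2 = (2 x - y')^2 + 2 t (y' - y)^2 >= 0, where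
   y, y' are the n-th and (n+1)-st means and x = x_{n+1} = (t + 1) y' - t y. *)
suff : \sum_(0 <= i < n.+1) y i ^+ 2 + 2 * (W n / w n) * y n ^+ 2
    <= 4 * \sum_(0 <= i < n.+1) x i ^+ 2.
  apply: le_trans; rewrite lerDl mulr_ge0 ?sqr_ge0// mulr_ge0// divr_ge0//.
    exact/ltW/W_gt0.
  exact/ltW/w_gt0.
elim: n => [|n IHn].
  have y0 : y 0%N = x 0%N.
    by rewrite /y !big_nat1 /weighted_mean /= big_nat1 divff ?mul1r// gt_eqF.
  rewrite !big_nat1 divff ?gt_eqF// -/(y 0%N) y0; have := sqr_ge0 (x 0%N); lra.
rewrite big_nat_recr//= [\sum_(0 <= i < n.+2) x i ^+ 2]big_nat_recr//=.
rewrite mulrDr -addrA.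
suff h : y n.+1 ^+ 2 + 2 * (W n.+1 / w n.+1) * y n.+1 ^+ 2 -
    2 * (W n / w n) * y n ^+ 2 <= 4 * x n.+1 ^+ 2 by lra.
have := weighted_mean_sumS x n; rewrite -/(y _) -/(y _) WS.
move: (W_gt0 n) (w_gt0 n) (w_gt0 n.+1) (w_ndecr n).
move: (y n.+1) (y n) (x n.+1) (W n) (w n) (w n.+1) => y1 y0 x1 W0 w0 w1.
move=> W0p w0p w1p w01 e.
have t0 : 0 <= W0 / w1 by rewrite divr_ge0//; exact: ltW.
(* Monotonicity of the weights enters here: the boundary term from the induction hypothesis, with
   ratio [W0 / w0], dominates the one with ratio t. *)
have tt : W0 / w1 <= W0 / w0.
  by rewrite ler_wpM2l ?lef_pV2 ?posrE//; exact: ltW.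
have x1E : x1 = (W0 / w1 + 1) * y1 - W0 / w1 * y0.
  apply: (@mulfI _ w1); first by rewrite gt_eqF.
  transitivity ((W0 + w1) * y1 - W0 * y0); first by rewrite e; ring.
  by field; rewrite gt_eqF.
rewrite [(W0 + w1) / w1]mulrDl divff ?gt_eqF// x1E.
have /(ler_wpM2r (sqr_ge0 y0)) := tt.
move: (W0 / w1) (W0 / w0) t0 => t t' t0.
have := mulr_ge0 t0 (sqr_ge0 (y1 - y0)).
have := sqr_ge0 (2 * ((t + 1) * y1 - t * y0) - y1).
lra.
Qed.

(** Rows are finite, so the matrix acts on all sequences and the algebra below needs no
    convergence. *)
Definition weighted_mean_op (u : nat -> Cplx R) (i : nat) : Cplx R :=
  \sum_(0 <= k < i.+1) ((weighted_mean w i k)%:C%C : Cplx R) * u k.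

Lemma weighted_mean_op_linear : linear weighted_mean_op.
Proof.
move=> a u v; apply/funext => i.
rewrite -[RHS]/(a * weighted_mean_op u i + weighted_mean_op v i).
rewrite /weighted_mean_op mulr_sumr -big_split; apply: eq_bigr => k _ /=.
rewrite -[(a *: u + v) k]/(a * u k + v k).
by rewrite mulrDr mulrCA.
Qed.

Lemma le_normc_sum (F : nat -> Cplx R) n :
  normc (\sum_(0 <= k < n) F k) <= \sum_(0 <= k < n) normc (F k).
Proof.
elim: n => [|n IHn]; first by rewrite !big_geq// ComplexField.Normc.normc0.
rewrite !big_nat_recr//=; apply: le_trans (lerD IHn (lexx _)).
exact: le_normcD.
Qed.

(** The entries are nonnegative, so the triangle inequality reduces this to the real Hardy
    inequality for the moduli. *)
Lemma weighted_mean_op_psum u n :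
  \sum_(0 <= i < n) normc (weighted_mean_op u i) ^+ 2
    <= 4 * \sum_(0 <= i < n) normc (u i) ^+ 2.
Proof.
apply: le_trans (weighted_mean_Hardy (fun k => normc (u k)) n).
apply: ler_sum => i _; rewrite ler_pXn2r ?nnegrE ?normc_ge0//; last first.
  apply: sumr_ge0 => k _; rewrite mulr_ge0 ?normc_ge0// /weighted_mean.
  by case: ifP => // _; rewrite divr_ge0// ltW.
apply: le_trans (le_normc_sum _ _) _; apply: ler_sum => k _.
rewrite ComplexField.Normc.normcM /= expr0n addr0 sqrtr_sqr ger0_norm//.
by rewrite /weighted_mean; case: ifP => // _; rewrite divr_ge0// ltW.
Qed.

Lemma weighted_mean_op_acts u i :
  series (fun j => ((weighted_mean w i j)%:C%C : Cplx R) * u j) @ \oo -->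
  weighted_mean_op u i.
Proof.
apply: cvg_near_cst; near=> n.
have ni : (i.+1 <= n)%N by near: n; exists i.+1.
rewrite /series /= (big_cat_nat (leq0n _) ni)/= [X in _ + X]big1_seq ?addr0//.
move=> j /andP[_]; rewrite mem_index_iota => /andP[ij _].
by rewrite /weighted_mean leqNgt ij mul0r.
Unshelve. all: by end_near. Qed.

Lemma weighted_mean_opS u n :
  (W n.+1)%:C%C * weighted_mean_op u n.+1 =
  (W n)%:C%C * weighted_mean_op u n + (w n.+1)%:C%C * u n.+1.
Proof.
have key m : (W m)%:C%C * weighted_mean_op u m =
    \sum_(0 <= k < m.+1) (w k)%:C%C * u k.
  rewrite mulr_sumr; apply: eq_big_nat => k /andP[_ km].
  by rewrite mulrA -rmorphM weighted_meanE// mulrCA mulfV ?gt_eqF// mulr1.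
by rewrite !key big_nat_recr.
Qed.

(* The formal inverse of the adjoint of the weighted mean matrix, applied to the
   weighted means. *)
Definition weighted_mean_factor (u : nat -> Cplx R) (i : nat) : Cplx R :=
  (W i)%:C%C * (weighted_mean_op u i / (w i)%:C%C -
                weighted_mean_op u i.+1 / (w i.+1)%:C%C).

Lemma weighted_mean_factor_linear : linear weighted_mean_factor.
Proof.
move=> a u v; apply/funext => i.
rewrite -[RHS]/(a * weighted_mean_factor u i + weighted_mean_factor v i).
rewrite /weighted_mean_factor weighted_mean_op_linear.
set f := weighted_mean_op u; set g := weighted_mean_op v.
rewrite -[(a *: f + g) i]/(a * f i + g i).
rewrite -[(a *: f + g) i.+1]/(a * f i.+1 + g i.+1).
ring.
Qed.

(** The recurrence [weighted_mean_opS] eliminates the mean at [i.+1]. This exposes a cancellation: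
    the ratio W_i / w_i alone may be unbounded. *)
Lemma weighted_mean_factorE u i : weighted_mean_factor u i =
  (W i * ((w i)^-1 - W i / (w i.+1 * W i.+1)))%:C%C * weighted_mean_op u i
  - (W i / W i.+1)%:C%C * u i.+1.
Proof.
have nz (r : R) : 0 < r -> r%:C%C != 0 :> Cplx R.
  by move=> r0; rewrite fmorph_eq0 gt_eqF.
rewrite /weighted_mean_factor.
have -> : weighted_mean_op u i.+1 =
  ((W i)%:C%C * weighted_mean_op u i + (w i.+1)%:C%C * u i.+1) / (W i.+1)%:C%C.
  by rewrite -weighted_mean_opS mulrAC divff ?mul1r// nz.
rewrite rmorphM rmorphB !fmorph_div rmorphM fmorphV /=.
have := (nz _ (W_gt0 i.+1), nz _ (w_gt0 i), nz _ (w_gt0 i.+1)).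
move: (W i.+1)%:C%C (W i)%:C%C (w i)%:C%C (w i.+1)%:C%C => W1 W0 w0 w1.
move=> [[W1n w0n] w1n]; field.
by rewrite W1n w0n w1n.
Qed.

(** From (p + q)^2 <= 2 p^2 + 2 q^2; the 8 is this 2 times Hardy's constant 4. *)
Lemma weighted_mean_factor_psum (c : R) u n :
    (forall i, W i * ((w i)^-1 - W i / (w i.+1 * W i.+1)) <= c) ->
  \sum_(0 <= i < n) normc (weighted_mean_factor u i) ^+ 2
    <= (8 * c ^+ 2 + 2) * \sum_(0 <= i < n.+1) normc (u i) ^+ 2.
Proof.
move=> Wc.
(* Nonnegativity, from w_i W_i <= w_{i+1} W_{i+1}, turns the upper bound [c] into a bound on the
   modulus. *)
have coef_ge0 i : 0 <= W i * ((w i)^-1 - W i / (w i.+1 * W i.+1)).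
  rewrite mulr_ge0 ?(ltW (W_gt0 i))// subr_ge0.
  rewrite ler_pdivrMr ?mulr_gt0// ler_pdivlMl//.
  rewrite ler_pM ?(ltW (W_gt0 i)) ?(ltW (w_gt0 i))//.
  by rewrite WS lerDl ltW.
have le1 i : normc (weighted_mean_factor u i) ^+ 2 <=
    2 * c ^+ 2 * normc (weighted_mean_op u i) ^+ 2 + 2 * normc (u i.+1) ^+ 2.
  have : normc (weighted_mean_factor u i) <=
      c * normc (weighted_mean_op u i) + normc (u i.+1).
    rewrite weighted_mean_factorE; apply: le_trans (le_normcD _ _) _.
    rewrite normcN !ComplexField.Normc.normcM /= !expr0n !addr0 !sqrtr_sqr.
    rewrite ger0_norm ?coef_ge0// ger0_norm ?divr_ge0 ?(ltW (W_gt0 _))//.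
    apply: lerD; first by rewrite ler_wpM2r ?normc_ge0.
    rewrite -[leRHS]mul1r ler_wpM2r ?normc_ge0// ler_pdivrMr// mul1r.
    by rewrite WS lerDl ltW.
  move: (normc_ge0 (weighted_mean_factor u i)).
  move: (normc (weighted_mean_factor u i)) (normc (weighted_mean_op u i)).
  move: (normc (u i.+1)) => z x y x0 xyz.
  have : x ^+ 2 <= (c * y + z) ^+ 2.
    by rewrite !expr2 ler_pM.
  have := sqr_ge0 (c * y - z); lra.
apply: le_trans (ler_sum _ (fun i _ => le1 i)) _.
rewrite big_split /= -!mulr_sumr.
have := weighted_mean_op_psum u n.
have : \sum_(0 <= i < n) normc (u i.+1) ^+ 2 <=
    \sum_(0 <= i < n.+1) normc (u i) ^+ 2.
  by rewrite [leRHS]big_nat_recl//= lerDr sqr_ge0.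
have : \sum_(0 <= i < n) normc (u i) ^+ 2 <=
    \sum_(0 <= i < n.+1) normc (u i) ^+ 2.
  by rewrite [leRHS]big_nat_recr//= lerDl sqr_ge0.
move: (\sum_(0 <= i < n) normc (u i) ^+ 2) (\sum_(0 <= i < n.+1) _).
move=> s0 s1 s01 + h; move/(le_trans h) : (ler_wpM2l (ler0n _ 4) s01).
move/(ler_wpM2l (mulr_ge0 (ler0n _ 2) (sqr_ge0 c))); lra.
Qed.

(** Terms with k < i vanish; for k >= i the factor W_k cancels, leaving w_i times a difference of
    consecutive values of (M u)_k / w_k, which telescopes. *)
Lemma weighted_mean_factor_partial u i n : (i <= n)%N ->
  \sum_(0 <= k < n)
    weighted_mean_factor u k * ((weighted_mean w k i)%:C%C : Cplx R)
  = weighted_mean_op u i - (w i / w n)%:C%C * weighted_mean_op u n.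
Proof.
elim: n => [|n IHn].
  rewrite leqn0 => /eqP ->.
  by rewrite big_geq// divff ?gt_eqF// rmorph1 mul1r subrr.
rewrite leq_eqVlt ltnS => /predU1P[->|i_n].
  rewrite divff ?gt_eqF// rmorph1 mul1r subrr big_nat_cond big1// => k.
  rewrite andbT => /andP[_ kn].
  by rewrite /weighted_mean leqNgt kn mulr0.
rewrite big_nat_recr//= IHn// weighted_meanE// /weighted_mean_factor.
have nz (r : R) : 0 < r -> r%:C%C != 0 :> Cplx R.
  by move=> r0; rewrite fmorph_eq0 gt_eqF.
rewrite !fmorph_div /=.
have := (nz _ (W_gt0 n), nz _ (w_gt0 n), nz _ (w_gt0 n.+1)).
move: (W n)%:C%C (w n)%:C%C (w n.+1)%:C%C (w i)%:C%C => W0 w0 w1 wi.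
move=> [[W0n w0n] w1n]; field.
by rewrite W0n w1n w0n.
Qed.

Lemma weighted_mean_posinormal (c : R) :
    (forall i, W i * ((w i)^-1 - W i / (w i.+1 * W i.+1)) <= c) ->
  exists M : {linear l2 R -> l2 R},
    acts_as_matrix (fun i j => (weighted_mean w i j)%:C%C) M /\
    posinormal (@l2_dot R) M.
Proof.
move=> Wc.
have M_psum u n : \sum_(0 <= i < n) normc (weighted_mean_op u i) ^+ 2
    <= 4 * \sum_(0 <= i < n.+1) normc (u i) ^+ 2.
  apply: le_trans (weighted_mean_op_psum u n) _.
  by rewrite ler_wpM2l// [leRHS]big_nat_recr//= lerDl sqr_ge0.
have [M ME Mc] := l2_operator_of_psum weighted_mean_op_linear (ler0n _ 4)
  M_psum.
have d0 : 0 <= 8 * c ^+ 2 + 2 by have := sqr_ge0 c; lra.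
have [B BE Bd] := l2_operator_of_psum weighted_mean_factor_linear d0
  (fun u n => weighted_mean_factor_psum u n Wc).
exists M; split; first by move=> f i; rewrite ME; exact: weighted_mean_op_acts.
apply: (posinormal_of_factor (ler0n _ 4) Mc d0 Bd) => f i.
apply/esym; apply: cvg_lim => //.
have MdE k : M (l2_delta i) k = (weighted_mean w k i)%:C%C.
  rewrite ME /weighted_mean_op; have [ik|ki] := leqP i k.
    rewrite (bigD1_seq i) ?iota_uniq ?mem_index_iota//=.
    rewrite eqxx mulr1 big1 ?addr0// => j /negPf ->.
    by rewrite mulr0.
  rewrite [in RHS]/weighted_mean leqNgt ki big_nat_cond big1// => j.
  rewrite andbT ltnS => /andP[_ jk].
  by rewrite /= ltn_eqF ?mulr0// (leq_ltn_trans jk).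
have pE n : (i <= n)%N -> series (fun k => B f k * conjC (M (l2_delta i) k)) n =
    M f i - (w i / w n)%:C%C * M f n.
  move=> i_n; rewrite !(ME f) -weighted_mean_factor_partial//.
  apply: eq_bigr => k _; rewrite BE MdE; congr (_ * _).
  by apply/eqP; rewrite eq_complex /= oppr0 !eqxx.
have wle m : (i <= m)%N -> w i <= w m.
  elim: m => [|m IHm]; first by rewrite leqn0 => /eqP ->.
  rewrite leq_eqVlt ltnS => /predU1P[-> //|/IHm im].
  exact: le_trans im (w_ndecr m).
(* It remains to see that (w_i / w_n) (M f)_n tends to 0: the ratio is at most 1, and (M f)_n tends
   to 0 because [M f] is square-summable. *)
apply/cvgrPdist_lt => e e0.
have /asboolP/cvg_series_cvg_0/cvgrPdist_lt cM := l2_valP (M f).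
near=> n.
have i_n : (i <= n)%N by near: n; exists i.
rewrite pE// opprB addrCA subrr addr0 normrM norm_Cplx.
apply: (@le_lt_trans _ _ `|M f n|).
  rewrite -[leRHS]mul1r ler_wpM2r//.
  rewrite lecR /= expr0n addr0 sqrtr_sqr ger0_norm ?divr_ge0 ?(ltW (w_gt0 _))//.
  by rewrite ler_pdivrMr// mul1r wle.
rewrite -(@ltr_pXn2r _ 2) ?nnegrE// ?ltW//.
rewrite -[ltLHS]ger0_norm ?exprn_ge0// -normrN -sub0r.
by near: n; apply: cM; rewrite exprn_gt0.
Unshelve. all: by end_near. Qed.

End weighted_means.

(** * Arithmetic weights: bounding the coefficients c_i *)

Theorem theorem2p2 (R : realType) (a b : R) (a_gt0 : 0 < a) (b_gt0 : 0 < b) :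
  exists M : {linear l2 R -> l2 R},
    acts_as_matrix (fun i j => (weighted_mean (fun n => a * n%:R + b) i j)%:C%C) M /\
    posinormal (@l2_dot R) M.
Proof.
set w := fun n : nat => a * n%:R + b.
have wb n : b <= w n by rewrite lerDr mulr_ge0// ltW.
have w_gt0 n : 0 < w n by exact: lt_le_trans (wb n).
have wS n : w n.+1 = w n + a by rewrite /w -natr1; ring.
apply: (@weighted_mean_posinormal _ w _ _ (2 + a / b)) => // [n|n].
  by rewrite wS lerDl ltW.
(* Inductive step: the right side grows by w_{n+1} (w_{n+2} - w_n) = 2 a w_{n+1}, the left side by a
   w_{n+1}. *)
have aW : a * \sum_(0 <= k < n.+1) w k <= w n * w n.+1.
  elim: n => [|n IHn].
    rewrite big_nat1 wS; have := w_gt0 0%N; move: (w 0%N) => w0 w0p.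
    by rewrite mulrC ler_pM2l// lerDr ltW.
  rewrite big_nat_recr//= mulrDr [w n.+2]wS.
  move: IHn; rewrite wS; move: (w n) (w_gt0 n) => x x0.
  have := mulr_gt0 a_gt0 x0; have := sqr_ge0 a; nra.
have Wp : 0 < \sum_(0 <= k < n.+1) w k.
  by rewrite big_nat_recr//= ltr_wpDl// sumr_ge0// => k _; exact: ltW.
rewrite [\sum_(0 <= k < n.+2) w k]big_nat_recr//=.
have := w_gt0 n.+1; have := wb n; have := w_gt0 n.
move: aW Wp; rewrite wS; move: (\sum_(0 <= k < n.+1) w k) (w n) => W x.
move=> aW Wp x0 bx x1.
have W1 : 0 < W + (x + a) by exact: addr_gt0.
(* In this form the outer ratio is at most 1, the first summand is at most 1 by [aW], and a / x <= a
   / b; hence the constant 2 + a / b. *)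
have -> : W * (x^-1 - W / ((x + a) * (W + (x + a)))) =
    W / (W + (x + a)) * (a * W / (x * (x + a)) + (1 + a / x)).
  by field; rewrite !gt_eqF.
have h1 : W / (W + (x + a)) <= 1 by rewrite ler_pdivrMr// mul1r lerDl ltW.
have h2 : a * W / (x * (x + a)) <= 1 by rewrite ler_pdivrMr ?mulr_gt0// mul1r.
have h3 : a / x <= a / b by rewrite ler_pM2l// lef_pV2.
have h4 : 0 <= a * W / (x * (x + a)) + (1 + a / x).
  by rewrite !addr_ge0// divr_ge0// ltW// mulr_gt0.
apply: le_trans (ler_wpM2r h4 h1) _; lra.
Qed.
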